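(* Let $\mathcal{M}$ be a smooth manifold with Riemannian metric $g$, let $\nabla$ be an affine connection on $\mathcal{M}$ and $\nabla^{\star}$ its torsion dual, and suppose that both $\nabla$ and $\nabla^{\star}$ are metric ($\nabla g=0$ and $\nabla^{\star}g=0$). Then the Ricci scalars of the two connections are identical: $$\mathrm{Ric}(\nabla)=\mathrm{Ric}(\nabla^{\star}).$$ Consequently, if $\nabla$ is scalar flat (i.e. $\mathrm{Ric}(\nabla)=0$), then so is $\nabla^{\star}$, and vice versa.
   Context: All objects are smooth. Connection coefficients are defined by $\nabla_{\partial_i}\partial_j=\Gamma^{k}{}_{ji}\partial_k$ (note the index order). Torsion dual: the torsion dual connection $\nabla^{\star}$ of an affine connection $\nabla$ is the affine connection defined by $\nabla_XY-\nabla^{\star}_YX-[X,Y]=0$ for all smooth vector fields $X,Y$; in local coordinates, $\Gamma^{\star\, i}{}_{kj}=\Gamma^{i}{}_{jk}$. Curvature: $R(X,Y)Z=\nabla_X\nabla_YZ-\nabla_Y\nabla_XZ-\nabla_{[X,Y]}Z$, with components $R(\partial_i,\partial_j)\partial_k=R^{m}{}_{kij}\partial_m$. The Ricci scalar of a connection is the function $\mathrm{Ric}(\nabla)=R^{m}{}_{imj}\,g^{ij}$, where $R$ is the curvature of that connection. *)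

(* Defs.v *)
From HB Require Import structures.
From mathcomp Require Import all_boot all_order all_algebra.
From mathcomp Require Import all_classical all_reals all_analysis.
From mathcomp Require Import ring.

Set Implicit Arguments.
Unset Strict Implicit.
Unset Printing Implicit Defensive.

Import Order.TTheory GRing.Theory Num.Theory.
Import numFieldNormedType.Exports.

Local Open Scope classical_set_scope.
Local Open Scope ring_scope.

Section SmoothMaps.
Context {R : realType} {n : nat}.
Local Notation E := 'rV[R]_n.

(* U is always open below. *)
Fixpoint Ck_on (k : nat) (V : normedModType R) (U : set E) (f : E -> V) :
    Prop :=
  if k is k'.+1 then
    (forall x, U x -> differentiable f x) /\
    (forall v, Ck_on k' U ('D_v f))
  else forall x, U x -> {for x, continuous f}.

Definition smooth_on (V : normedModType R) (U : set E) (f : E -> V) : Prop :=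
  forall k, Ck_on k U f.

Lemma near_eq_differentiable (V : normedModType R) (f g : E -> V) (x : E) :
  (\near x, f x = g x) -> differentiable f x -> differentiable g x.
Proof.
move=> fg fd; have fgx := nbhs_singleton fg.
have [fc /eqaddoP fo] := (diff_locallyP _ _).1 fd.
have go : g \o shift x = cst (g x) + 'd f x +o_ (0 : E) id.
  apply/eqaddoP => e e0; have fe := fo e e0.
  have fg0 : \forall h \near (0 : E), f (h + x) = g (h + x).
    by move: fg; rewrite (near_shift 0) /= subr0.
  near=> h; have -> : (g \o shift x - (cst (g x) + 'd f x)) h
      = (f \o shift x - (cst (f x) + 'd f x)) h.
    by rewrite !fctE /= fgx; congr (_ - _); apply/esym; near: h.
  by near: h.
apply/diff_locallyP; rewrite (diff_unique fc go) //.
Unshelve. all: by end_near. Qed.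

Lemma Ck_on_ext k (V : normedModType R) (U : set E) (f g : E -> V) :
  open U -> (forall x, U x -> f x = g x) -> Ck_on k U f -> Ck_on k U g.
Proof.
move=> Uo; elim: k f g => [|k IH] f g fg;
  have nfg x : U x -> \forall y \near x, f y = g y;
  try (by move=> Ux; near=> y; apply: fg; near: y; exact: open_nbhs_nbhs).
  move=> fc x Ux; have := fc x Ux.
  rewrite /prop_for /continuous_at -(fg x Ux); apply: cvg_trans.
  exact: (near_eq_cvg (nfg x Ux)).
case=> [fd fk]; split=> [x Ux|v].
  exact: near_eq_differentiable (nfg _ Ux) (fd _ Ux).
by apply: IH (fk v) => x Ux; apply: near_eq_derive; exact: nfg.
Unshelve. all: by end_near. Qed.

Lemma Ck_on_prev k (V : normedModType R) (U : set E) (f : E -> V) :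
  Ck_on k.+1 U f -> Ck_on k U f.
Proof.
elim: k f => [|k IH] f [fd fk].
  by move=> x Ux; exact/differentiable_continuous/fd.
by split=> // v; apply: IH; exact: fk.
Qed.

Lemma Ck_on_cst k (V : normedModType R) (U : set E) (a : V) :
  Ck_on k U (cst a : E -> V).
Proof.
elim: k a => [|k IH] a /=; first by move=> x _; exact: cst_continuous.
split=> [x _|v]; first exact: differentiable_cst.
have -> : 'D_v (cst a : E -> V) = cst 0 by apply/funext=> x; exact: derive_cst.
exact: IH.
Qed.

Lemma Ck_onD k (V : normedModType R) (U : set E) (f g : E -> V) :
  open U -> Ck_on k U f -> Ck_on k U g -> Ck_on k U (f + g).
Proof.
move=> Uo; elim: k f g => [|k IH] f g.
  by move=> fc gc x Ux; apply: continuousD; [exact: fc|exact: gc].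
case=> [fd fk] [gd gk]; split=> [x Ux|v].
  by apply: differentiableD; [exact: fd|exact: gd].
apply: Ck_on_ext (IH _ _ (fk v) (gk v)) => // x Ux.
by rewrite deriveD//; apply: diff_derivable; [exact: fd|exact: gd].
Qed.

Lemma Ck_onM k (U : set E) (f g : E -> R) :
  open U -> Ck_on k U f -> Ck_on k U g -> Ck_on k U (f * g).
Proof.
move=> Uo; elim: k f g => [|k IH] f g fk gk.
  by move=> x Ux; apply: continuousM; [exact: fk|exact: gk].
case: (fk) (gk) => [fd fk'] [gd gk']; split=> [x Ux|v].
  by apply: differentiableM; [exact: fd|exact: gd].
have H : Ck_on k U (f * 'D_v g + g * 'D_v f).
  by apply: Ck_onD Uo (IH _ _ (Ck_on_prev fk) (gk' v)) _;
    exact: IH (Ck_on_prev gk) (fk' v).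
apply: Ck_on_ext H => // x Ux.
by rewrite deriveM//; apply: diff_derivable; [exact: fd|exact: gd].
Qed.

End SmoothMaps.

Record chart (R : realType) (n : nat) (M : topologicalType) := Chart {
  chart_dom : set M;
  chart_map :> M -> 'rV[R]_n;
  chart_inv : 'rV[R]_n -> M;
  open_chart_dom : open chart_dom;
  open_chart_img : open (chart_map @` chart_dom);
  chart_mapK : forall p, chart_dom p -> chart_inv (chart_map p) = p;
  chart_map_continuous :
    forall p, chart_dom p -> {for p, continuous chart_map};
  chart_inv_continuous :
    forall x, (chart_map @` chart_dom) x -> {for x, continuous chart_inv} }.

Arguments open_chart_dom {R n M} c : rename.
Arguments open_chart_img {R n M} c : rename.

Definition chart_img (R : realType) (n : nat) (M : topologicalType)
  (c : chart R n M) : set 'rV[R]_n := c @` chart_dom c.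

(* The atlas is not required to be maximal: any smooth atlas determines the
   smooth structure. *)
Record smooth_manifold (R : realType) (n : nat) := SmoothManifold {
  manifold_space :> topologicalType;
  manifold_hausdorff : hausdorff_space manifold_space;
  manifold_second_countable : @second_countable manifold_space;
  atlas : set (chart R n manifold_space);
  atlas_cover : forall p, exists2 c, atlas c & chart_dom c p;
  atlas_compatible : forall c c', atlas c -> atlas c' ->
    smooth_on (c @` (chart_dom c `&` chart_dom c')) (c' \o chart_inv c) }.

Arguments atlas {R n} M : rename.

Section SmoothFunctions.
Context {R : realType} {n : nat} (M : smooth_manifold R n).

Definition smooth_fun : {pred M -> R} := [pred f : M -> R |
  `[< forall c, atlas M c -> smooth_on (chart_img c) (f \o chart_inv c) >]].

Lemma smooth_funP (f : M -> R) : reflect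
  (forall c, atlas M c -> smooth_on (chart_img c) (f \o chart_inv c))
  (f \in smooth_fun).
Proof. exact: asboolP. Qed.

Lemma smooth_fun_cst (a : R) : cst a \in smooth_fun.
Proof. by apply/smooth_funP => c _ k; exact: Ck_on_cst. Qed.

Lemma smooth_funD f g :
  f \in smooth_fun -> g \in smooth_fun -> f + g \in smooth_fun.
Proof.
move=> /smooth_funP sf /smooth_funP sg; apply/smooth_funP => c Mc k.
exact: (Ck_onD (open_chart_img c) (sf c Mc k) (sg c Mc k)).
Qed.

Lemma smooth_funM f g :
  f \in smooth_fun -> g \in smooth_fun -> f * g \in smooth_fun.
Proof.
move=> /smooth_funP sf /smooth_funP sg; apply/smooth_funP => c Mc k.
exact: (Ck_onM (open_chart_img c) (sf c Mc k) (sg c Mc k)).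
Qed.

Lemma smooth_fun_subring : subring_closed smooth_fun.
Proof.
split; first exact: smooth_fun_cst.
  move=> f g sf sg; apply: smooth_funD => //.
  by rewrite -mulN1r; apply: smooth_funM => //; exact: (smooth_fun_cst (-1)).
exact: smooth_funM.
Qed.

Lemma smooth_fun_submod : submod_closed (smooth_fun : {pred M -> R^o}).
Proof.
split; first exact: (smooth_fun_cst 0).
move=> a f g sf sg; apply: smooth_funD => //.
exact: (smooth_funM (smooth_fun_cst a) sf).
Qed.

HB.instance Definition _ :=
  GRing.isSubringClosed.Build (M -> R) smooth_fun smooth_fun_subring.

HB.instance Definition _ :=
  GRing.isSubmodClosed.Build R (M -> R^o) smooth_fun smooth_fun_submod.

Record Cinf := MkCinf {
  Cinf_fun :> M -> R;
  Cinf_smooth : Cinf_fun \in smooth_fun }.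

HB.instance Definition _ := [isSub for Cinf_fun].
HB.instance Definition _ := [Choice of Cinf by <:].
HB.instance Definition _ := 
  GRing.SubChoice_isSubComPzRing.Build (M -> R) smooth_fun Cinf
    (GRing.subringClosedP smooth_fun).
HB.instance Definition _ := 
  GRing.SubZmodule_isSubLmodule.Build R (M -> R^o) smooth_fun Cinf
    (GRing.subsemimodClosedP smooth_fun).


Lemma Cinf_eqP (f g : Cinf) : (forall p, f p = g p) -> f = g.
Proof. by move=> fg; apply/val_inj/funext. Qed.

Lemma CinfD (f g : Cinf) p : (f + g) p = f p + g p. Proof. by []. Qed.
Lemma CinfN (f : Cinf) p : (- f) p = - f p. Proof. by []. Qed.
Lemma CinfM (f g : Cinf) p : (f * g) p = f p * g p. Proof. by []. Qed.
Lemma CinfZ (a : R) (f : Cinf) p : (a *: f) p = a * f p. Proof. by []. Qed.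
Definition CinfE := (CinfD, CinfN, CinfM, CinfZ).

Definition derivation_at (p : M) : {pred Cinf -> R^o} :=
  [pred v : Cinf -> R^o | `[< (forall (a : R) (f g : Cinf),
      v (a *: f + g) = a * v f + v g) /\
    (forall f g : Cinf, v (f * g) = v f * g p + f p * v g) >]].

Lemma derivation_at_submod p : submod_closed (derivation_at p).
Proof.
split.
  by apply/asboolP; split=> [a f g|f g]; rewrite /= ?(mul0r, mulr0) addr0.
move=> b u v /asboolP[ul uM] /asboolP[vl vM]; apply/asboolP; split=> [a f g|f g].
  rewrite !fctE ul vl /GRing.scale/= !mulrDr !addrA; congr (_ + _).
  by rewrite addrAC mulrCA.
rewrite !fctE uM vM /GRing.scale/= !mulrDr mulrDl !addrA; congr (_ + _).
by rewrite addrAC mulrA [b * (f p * _)]mulrCA.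
Qed.

HB.instance Definition _ p :=
  GRing.isSubmodClosed.Build R (Cinf -> R^o) (derivation_at p)
    (derivation_at_submod p).

Record tangent (p : M) := Tangent {
  tangent_fun :> Cinf -> R^o;
  tangent_derivation : tangent_fun \in derivation_at p }.

HB.instance Definition _ p := [isSub for @tangent_fun p].
HB.instance Definition _ p := [Choice of tangent p by <:].
HB.instance Definition _ p := [SubChoice_isSubLmodule of tangent p by <:].

Definition derivation : {pred Cinf -> Cinf^o} :=
  [pred X : Cinf -> Cinf^o | `[< (forall (a : R) (f g : Cinf),
      X (a *: f + g : Cinf) = a *: (X f : Cinf) + X g :> Cinf) /\
    (forall f g : Cinf, X (f * g) = X f * g + f * X g :> Cinf) >]].

Lemma derivationP (X : Cinf -> Cinf^o) : reflect
  ((forall (a : R) (f g : Cinf) p,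
      (X (a *: f + g) : Cinf) p = a * (X f : Cinf) p + (X g : Cinf) p) /\
   (forall (f g : Cinf) p,
      (X (f * g) : Cinf) p = (X f : Cinf) p * g p + f p * (X g : Cinf) p))
  (X \in derivation).
Proof.
apply: (iffP (asboolP _)) => -[Xl XM]; split.
- by move=> a f g p; rewrite Xl.
- by move=> f g p; rewrite XM.
- by move=> a f g; apply/Cinf_eqP => p; exact: Xl.
- by move=> f g; apply/Cinf_eqP => p; exact: XM.
Qed.

Lemma derivation_submod : submod_closed derivation.
Proof.
split.
  apply/derivationP; split=> [a f g p|f g p].
    by rewrite -[LHS]/(0 : R) -[RHS]/(a * 0 + 0 : R) mulr0 addr0.
  by rewrite -[LHS]/(0 : R) -[RHS]/(0 * g p + f p * 0 : R) mulr0 mul0r addr0.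
move=> b X Y /derivationP[Xl XM] /derivationP[Yl YM].
have E h p : ((b *: X + Y) h : Cinf) p = b p * (X h : Cinf) p + (Y h : Cinf) p.
  by [].
by apply/derivationP; split=> *; rewrite !E ?(Xl, XM) ?(Yl, YM); ring.
Qed.

HB.instance Definition _ :=
  GRing.isSubmodClosed.Build Cinf (Cinf -> Cinf^o) derivation derivation_submod.

(* A smooth section p |-> X_p of the tangent bundle (X_p a derivation at p, and
   p |-> X_p f smooth for every smooth f) is the same thing as a derivation of
   the algebra of smooth functions; X_p is [vf_at X p] below. *)
Record vector_field := VectorField {
  vf_fun :> Cinf -> Cinf^o;
  vf_derivation : vf_fun \in derivation }.

HB.instance Definition _ := [isSub for vf_fun].
HB.instance Definition _ := [Choice of vector_field by <:].
HB.instance Definition _ := [SubChoice_isSubLmodule of vector_field by <:].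

Lemma vf_at_subproof (X : vector_field) (p : M) :
  (fun f => X f p) \in derivation_at p.
Proof.
have /derivationP[Xl XM] := vf_derivation X; apply/asboolP.
by split=> [a f g|f g]; rewrite ?Xl ?XM.
Qed.

Definition vf_at (X : vector_field) (p : M) : tangent p :=
  Tangent (vf_at_subproof X p).

Lemma lie_bracket_subproof (X Y : vector_field) :
  (fun f => X (Y f) - Y (X f)) \in derivation.
Proof.
have /asboolP[Xl XM] := vf_derivation X.
have /asboolP[Yl YM] := vf_derivation Y.
have XD f g : X (f + g) = X f + X g by have := Xl 1 f g; rewrite !scale1r.
have YD f g : Y (f + g) = Y f + Y g by have := Yl 1 f g; rewrite !scale1r.
have E h p : (X (Y h) - Y (X h) : Cinf) p = X (Y h) p - Y (X h) p by [].
apply/derivationP; split=> [a f g p|f g p]; rewrite !E.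
  by rewrite Xl Yl Xl Yl !CinfE; ring.
by rewrite XM YM XD YD !XM !YM !CinfE; ring.
Qed.

Definition lie_bracket (X Y : vector_field) : vector_field :=
  VectorField (lie_bracket_subproof X Y).

End SmoothFunctions.

Arguments smooth_fun {R n} M.

Section Connections.
Context {R : realType} {n : nat} (M : smooth_manifold R n).

(* Homogeneity over R in the second argument is [nabla_leibniz] for a constant
   function f. *)
Record affine_connection := AffineConnection {
  nabla :> vector_field M -> vector_field M -> vector_field M;
  nabla_linearl : forall (f : Cinf M) (X Y Z : vector_field M),
    nabla (f *: X + Y) Z = f *: nabla X Z + nabla Y Z;
  nabla_addr : forall X Y Z : vector_field M,
    nabla X (Y + Z) = nabla X Y + nabla X Z;
  nabla_leibniz : forall (f : Cinf M) (X Y : vector_field M),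
    nabla X (f *: Y) = (X f : Cinf M) *: Y + f *: nabla X Y }.

Record riemannian_metric := RiemannianMetric {
  metric_at : forall p : M, tangent p -> tangent p -> R;
  metric_linearl : forall p (a : R) (u v w : tangent p),
    metric_at (a *: u + v) w = a * metric_at u w + metric_at v w;
  metric_sym : forall p (u v : tangent p), metric_at u v = metric_at v u;
  metric_pos : forall p (u : tangent p), u != 0 -> 0 < metric_at u u;
  metric_smooth : forall X Y : vector_field M,
    (fun p => metric_at (vf_at X p) (vf_at Y p)) \in smooth_fun M }.

Definition metric_vf (g : riemannian_metric) (X Y : vector_field M) : Cinf M :=
  MkCinf (metric_smooth g X Y).

Definition is_torsion_dual (D D' : affine_connection) : Prop :=
  forall X Y : vector_field M, D X Y - D' Y X - lie_bracket X Y = 0.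

Definition nabla_metric (D : affine_connection) (g : riemannian_metric)
    (X Y Z : vector_field M) : Cinf M :=
  (X (metric_vf g Y Z) : Cinf M)
    - metric_vf g (D X Y) Z - metric_vf g Y (D X Z).

Definition is_metric_connection (D : affine_connection)
    (g : riemannian_metric) : Prop :=
  forall X Y Z : vector_field M, nabla_metric D g X Y Z = 0.

Definition curvature (D : affine_connection) (X Y Z : vector_field M) :
    vector_field M :=
  D X (D Y Z) - D Y (D X Z) - D (lie_bracket X Y) Z.

(* Connections act on global vector fields, whereas the coordinate fields of a
   chart c are defined on its domain only; near p they are represented by
   global fields E i that coincide with them on a neighbourhood of p. *)
Definition coordinate_fields (c : chart R n M) (p : M)
    (E : 'I_n -> vector_field M) : Prop :=
  \forall q \near p, forall (i : 'I_n) (f : Cinf M),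
    E i f q = 'D_(delta_mx 0 i) (f \o chart_inv c) (c q).

Definition coefficients (p : M) (e : 'I_n -> tangent p) (v : tangent p) :
    'rV[R]_n :=
  xget 0 [set a : 'rV[R]_n | v = \sum_(m < n) a 0 m *: e m].

Definition metric_matrix (g : riemannian_metric) (p : M)
    (e : 'I_n -> tangent p) : 'M[R]_n :=
  \matrix_(i, j) metric_at g (e i) (e j).

(* [curvature_coef D E p m k i j] is R^m_{kij} at p. *)
Definition curvature_coef (D : affine_connection)
    (E : 'I_n -> vector_field M) (p : M) (m k i j : 'I_n) : R :=
  coefficients (fun l => vf_at (E l) p)
    (vf_at (curvature D (E i) (E j) (E k)) p) 0 m.

(* The value does not depend on the chart c of the atlas around p nor on the
   representatives E of its coordinate fields. *)
Definition ricci_scalar (D : affine_connection) (g : riemannian_metric) :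
    M -> R :=
  fun p => xget 0 [set r | exists (c : chart R n M)
      (E : 'I_n -> vector_field M),
    [/\ atlas M c, chart_dom c p, coordinate_fields c p E &
      r = \sum_(i < n) \sum_(j < n) \sum_(m < n)
            curvature_coef D E p m i m j *
            invmx (metric_matrix g (fun l => vf_at (E l) p)) i j]].

Definition scalar_flat (D : affine_connection) (g : riemannian_metric) :
    Prop :=
  forall p, ricci_scalar D g p = 0.

End Connections.

(* Main.v *)
Require Import Defs.
From HB Require Import structures.
From mathcomp Require Import all_boot all_order all_algebra.
From mathcomp Require Import all_classical all_reals all_analysis.
From mathcomp Require Import ring lra.

(** Write T for D - D'. By duality T is the torsion of D, hence antisymmetric, and
subtracting the two metricity equations makes g(T(X,Y),Z) antisymmetric in
Y and Z; hence it is a 3-form. Expand R in g(R(X,Y)Y,X) with D = D' + T. Apart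
from g(R'(X,Y)Y,X), the terms that appear repeat an argument of the 3-form, or
add up to g(T(X,Y), D_Y X - D'_X Y + [X,Y]), where the second vector field is
zero by duality. So D and D' have the same unnormalised sectional curvature
([sectional_curvature_eq]). Polarising in X and in Y, the part of R - R' that is
symmetric under the exchanges of the first with the fourth and of the second
with the third argument vanishes ([curvature_gap_polarized]), and the Ricci
scalar, a contraction with two copies of the symmetric inverse metric, sees
only this part ([ricci_contraction_eq]). A chart and its coordinate fields thus
give the same value for D and for D', so both scalars are chosen from the same
set of values.

The definition of the scalar goes through coefficients in the coordinate frame
at p. To rewrite them with the metric ([coefficientsE]), the coordinate vectors
must be a basis of the space of derivations at p ([tangent_free],
[tangent_decomposition]). This is the classical argument: a bump function makes
the coordinates centred at p global, and Hadamard's lemma ([hadamard]) writes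
every function near p as its value at p plus a combination of these coordinates
with smooth factors, which a derivation at p evaluates by the Leibniz rule
([chart_coordinates]). The factors in Hadamard's lemma are means of partial
derivatives along segments, differentiated under the integral sign; the bump
function comes from exp(-1/t). *)

Set Implicit Arguments.
Unset Strict Implicit.
Unset Printing Implicit Defensive.

Import Order.TTheory GRing.Theory Num.Theory.
Import numFieldNormedType.Exports.

Local Open Scope classical_set_scope.
Local Open Scope ring_scope.

(** * Smooth maps between coordinate spaces *)

Section Calculus.
Context {R : realType}.

(** Directional derivatives are functions on the whole space, so [Ck_on] refers
to U only through a quantifier over its points; this makes smoothness local. *)
Lemma Ck_on_pointwise n k (V : normedModType R) (U : set 'rV[R]_n)
    (f : 'rV[R]_n -> V) :
  Ck_on k U f <-> forall x, U x -> Ck_on k [set x] f.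
Proof.
elim: k f => [|k IH] f /=.
  by split=> [fc x Ux y -> | fc x Ux]; [exact: fc | exact: (fc x)].
split=> [[fd fk] x Ux|fk].
  by split=> [y -> |v]; [exact: fd | have /IH := fk v; exact].
split=> [x Ux|v]; first by have [+ _] := fk x Ux; exact.
by apply/IH => x Ux; have [_ +] := fk x Ux; exact.
Qed.

Lemma Ck_on_subset n k (V : normedModType R) (U U' : set 'rV[R]_n)
    (f : 'rV[R]_n -> V) :
  U' `<=` U -> Ck_on k U f -> Ck_on k U' f.
Proof.
by move=> sU /Ck_on_pointwise fk; apply/Ck_on_pointwise => x /sU; exact: fk.
Qed.

Lemma Ck_on_local n k (V : normedModType R) (U : set 'rV[R]_n)
    (f : 'rV[R]_n -> V) :
  (forall x, U x -> exists W, exists2 h, [/\ open W, W x & Ck_on k W h] &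
    forall y, W y -> h y = f y) -> Ck_on k U f.
Proof.
move=> H; apply/Ck_on_pointwise => x /H[W [h [oW Wx hk] hf]].
exact: (Ck_on_pointwise k W f).1 (Ck_on_ext oW hf hk) x Wx.
Qed.

Lemma Ck_on_continuous n k (V : normedModType R) (U : set 'rV[R]_n)
    (f : 'rV[R]_n -> V) :
  Ck_on k U f -> forall x, U x -> {for x, continuous f}.
Proof. by elim: k => [//|k IH] /Ck_on_prev. Qed.

Lemma Ck_on_sum n k (I : Type) (s : seq I) (U : set 'rV[R]_n)
    (f : I -> 'rV[R]_n -> R) :
  open U -> (forall i, Ck_on k U (f i)) -> Ck_on k U (\sum_(i <- s) f i).
Proof.
move=> oU fk; elim/big_ind: _ => //; first exact: Ck_on_cst.
by move=> g h; exact: Ck_onD.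
Qed.

Lemma Ck_on_coord n m k (U : set 'rV[R]_n) (F : 'rV[R]_n -> 'rV[R]_m)
    (i : 'I_m) :
  open U -> Ck_on k U F -> Ck_on k U (fun x => F x 0 i).
Proof.
move=> oU; elim: k F => [|k IH] F.
  move=> Fc x Ux; apply: (@continuous_comp _ _ _ F (fun y : 'rV[R]_m => y 0 i)).
    exact: Fc.
  exact: coord_continuous.
case=> [Fd Fk]; split=> [x Ux|v].
  apply: (@differentiable_comp _ _ _ _ F (fun y : 'rV[R]_m => y 0 i)).
    exact: Fd.
  exact: differentiable_coord.
apply: Ck_on_ext (IH _ (Fk v)) => // x Ux.
by rewrite derive_mx ?mxE//; apply: diff_derivable; exact: Fd.
Qed.

Lemma derive_comp_sum n m (F : 'rV[R]_n -> 'rV[R]_m) (h : 'rV[R]_m -> R) x v :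
  differentiable F x -> differentiable h (F x) ->
  'D_v (h \o F) x = \sum_i ('D_v F x) 0 i * 'D_(delta_mx 0 i) h (F x).
Proof.
move=> Fd hd; rewrite deriveE; last exact: differentiable_comp.
rewrite diff_comp//= -(deriveE v Fd); set u := 'D_v F x.
rewrite [in LHS](row_sum_delta u) linear_sum.
by apply: eq_bigr => i _; rewrite linearZ/= -deriveE.
Qed.

(** By the chain rule a directional derivative of h o F is a sum of products of
components of a derivative of F and of functions h' o F with h' a partial
derivative of h, all of which the induction on k covers. *)
Lemma Ck_on_comp n m k (U : set 'rV[R]_n) (V : set 'rV[R]_m)
    (F : 'rV[R]_n -> 'rV[R]_m) (h : 'rV[R]_m -> R) :
  open U -> (forall x, U x -> V (F x)) ->
  Ck_on k U F -> Ck_on k V h -> Ck_on k U (h \o F).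
Proof.
move=> oU UV; elim: k h => [|k IH] h.
  move=> Fc hc x Ux; apply: continuous_comp; first exact: Fc.
  by apply: hc; exact: UV.
move=> Fk1 [hd hk]; have [Fd Fk] := Fk1; split=> [x Ux|v].
  by apply: differentiable_comp; [exact: Fd | apply: hd; exact: UV].
have H : Ck_on k U (\sum_(i < m) ((fun x => ('D_v F x) 0 i) *
    ('D_(delta_mx 0 i) h \o F))).
  apply: Ck_on_sum => // i; apply: Ck_onM => //.
    exact: (Ck_on_coord i oU (Fk v)).
  exact: IH (Ck_on_prev Fk1) (hk _).
apply: Ck_on_ext H => // x Ux; rewrite derive_comp_sum ?fct_sumE//.
  exact: Fd.
by apply: hd; exact: UV.
Qed.

Lemma coord_le_norm n (h : 'rV[R]_n) i : `|h 0 i| <= `|h|.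
Proof.
rewrite [leRHS]/Num.norm /= mx_normrE.
by apply: le_trans (le_bigmax _ _ (0, i)).
Qed.

(** This trades the differential of an integral depending on a parameter, a
linear map that would have to be constructed, for the numbers c. *)
Lemma differentiable_expansion n (f : 'rV[R]_n -> R) (x : 'rV[R]_n)
    (c : 'I_n -> R) :
  (forall e, 0 < e -> \forall h \near (0 : 'rV[R]_n),
     `|f (x + h) - f x - \sum_i h 0 i * c i| <= e * `|h|) ->
  differentiable f x /\ forall v, 'D_v f x = \sum_i v 0 i * c i.
Proof.
move=> H.
pose L (v : 'rV[R]_n) : R := \sum_i v 0 i * c i.
have Ll : linear L.
  move=> a u v; rewrite /L scaler_sumr -big_split/=; apply: eq_bigr => i _.
  by rewrite !mxE mulrDl -mulrA.
pose Lm := GRing.isLinear.Build R 'rV[R]_n R *:%R L Ll.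
pose LL : {linear 'rV[R]_n -> R} := HB.pack L Lm.
have Lc : continuous LL.
  apply: continuous_big => [|i _ v]; first exact: add_continuous.
  apply: (@continuousM _ _ (fun v : 'rV[R]_n => v 0 i) (cst (c i))).
    exact: coord_continuous.
  exact: cst_continuous.
have E : f \o shift x = cst (f x) + LL +o_ (0 : 'rV[R]_n) id.
  apply/eqaddoP => e e0; near=> h.
  rewrite !fctE /= [h + x]addrC opprD addrA.
  by near: h; exact: H.
have D := diff_unique Lc E.
have fd : differentiable f x by apply/diff_locallyP; rewrite D.
by split=> // v; rewrite deriveE// D.
Unshelve. all: by end_near. Qed.

End Calculus.

(** * Functions flat at the origin *)

Section Flat.
Context {R : realType}.

(** The usual exp(-1/t) is [flat 0]; the powers of 1/t make the family stable
under differentiation. *)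
Definition flat m (t : R) : R := if 0 < t then t^-1 ^+ m * expR (- t^-1) else 0.

(** exp(1/t) exceeds the term of degree m + 2 of its series. The exponent 2 on
the right is what forces a zero derivative at the origin. *)
Lemma flat_bound m (t : R) : `|flat m t| <= (m.+2)`!%:R * t ^+ 2.
Proof.
rewrite /flat; case: ifPn => [t0|_]; last first.
  by rewrite normr0 mulr_ge0// sqr_ge0.
have s0 : 0 < t^-1 by rewrite invr_gt0.
rewrite ger0_norm; last by rewrite mulr_ge0 ?exprn_ge0 ?expR_ge0// ltW.
rewrite expRN ler_pdivrMr ?expR_gt0//.
have H := expR_ge1Dxn m.+1 (ltW s0).
have f0 : 0 < (m.+2)`!%:R :> R by rewrite ltr0n fact_gt0.
have : t^-1 ^+ m.+2 / (m.+2)`!%:R <= expR t^-1.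
  by apply: le_trans H; rewrite lerDr.
rewrite ler_pdivrMr// => {}H.
have -> : t^-1 ^+ m = t^-1 ^+ m.+2 * t ^+ 2.
  by rewrite -[m.+2]addn2 exprD -mulrA -exprMn mulVf ?gt_eqF// expr1n mulr1.
rewrite [leRHS]mulrAC ler_wpM2r ?sqr_ge0//.
by rewrite mulrC.
Qed.

Lemma is_derive0_quadratic (f : R -> R) (C : R) :
  (forall t, `|f t| <= C * t ^+ 2) -> is_derive (0 : R) (1 : R) f 0.
Proof.
move=> H; have f0 : f 0 = 0.
  apply/normr0_eq0/le_anti; rewrite normr_ge0 (le_trans (H 0))//.
  by rewrite expr0n mulr0.
have C0 : 0 <= C by have := H 1; rewrite expr1n mulr1; exact: le_trans.
suff X : (fun h : R => h^-1 *: ((f \o shift 0) (h *: 1) - f 0)) @ 0^'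
    --> (0 : R).
  by split; [apply/cvg_ex; exists 0 | apply/cvg_lim].
apply/cvgr0Pnorm_le => e e0.
have d0 : 0 < e / (C + 1) by rewrite divr_gt0// ltr_wpDl.
near=> h.
have h0 : h != 0 by near: h; exact: nbhs_dnbhs_neq.
rewrite /= f0 subr0 addr0 /GRing.scale/= mulr1 normrM normfV.
rewrite ler_pdivrMl ?normr_gt0//.
apply: le_trans (H h) _; rewrite -(real_normK (num_real h)) expr2 mulrCA.
rewrite ler_wpM2l//.
have : `|h| <= e / (C + 1).
  by near: h; exact: dnbhs0_le.
rewrite ler_pdivlMr; last by rewrite ltr_wpDl.
by apply: le_trans; rewrite mulrC ler_wpM2l// lerDl.
Unshelve. all: by end_near. Qed.

Lemma is_derive_flat m (t : R) :
  is_derive (t : R) (1 : R) (flat m) (flat m.+2 t - m%:R * flat m.+1 t).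
Proof.
have [t0|t0|->] := ltgtP t 0; last first.
- rewrite /flat ltxx mulr0 subr0.
  exact: (is_derive0_quadratic (@flat_bound m)).
- pose i (u : R) : R := u^-1.
  pose f : R -> R := i ^+ m * (expR \o - i).
  have E : \near t, f t = flat m t.
    near=> u; rewrite /f !fctE/= /flat ifT//; near: u; exact: lt_nbhsr.
  apply: (near_eq_is_derive (f := f)); rewrite ?oner_neq0//.
  rewrite /flat t0.
  have tn : t != 0 by rewrite gt_eqF.
  have dV : is_derive t (1 : R) i (- t^-1 ^+ 2).
    apply: is_derive_eq; first exact: (@is_deriveV R id).
    by rewrite /GRing.scale /= mulr1 -exprVn.
  have dX := is_deriveX m dV.
  have dE := is_derive1_comp (is_derive_expR ((- i) t)) (is_deriveN dV).
  have dM := is_deriveM dX dE.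
  apply: (is_derive_eq dM).
  rewrite /GRing.scale/= !fctE /i opprK; case: (m) => [|k]/=.
    by rewrite !expr0 !mul0r subr0; ring.
  rewrite !exprS; ring.
- have E : \near t, cst 0 t = flat m t.
    near=> u; rewrite /flat ifF//; apply/negbTE; rewrite -leNgt ltW//.
    near: u; exact: lt_nbhsl.
  apply: (near_eq_is_derive (f := cst 0)); rewrite ?oner_neq0//.
  rewrite /flat ltNge (ltW t0) /= mulr0 subr0; exact: is_derive_cst.
Unshelve. all: try by end_near. Qed.

(** Stability of the family under differentiation closes the induction, for all
m simultaneously. *)
Lemma Ck_on_flat_comp n k m (U : set 'rV[R]_n) (q : 'rV[R]_n -> R) :
  open U -> Ck_on k U q -> Ck_on k U (flat m \o q).
Proof.
move=> oU; elim: k m => [|k IH] m.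
  move=> qc x Ux; apply: continuous_comp; first exact: qc.
  apply/differentiable_continuous/derivable1_diffP.
  by have [] := is_derive_flat m (q x).
move=> qk1; have [qd qk] := qk1.
have fd t : differentiable (flat m) t.
  by apply/derivable1_diffP; have [] := is_derive_flat m t.
split=> [x Ux|v]; first by apply: differentiable_comp; [exact: qd | exact: fd].
have H : Ck_on k U ((flat m.+2 \o q + cst (- m%:R) * (flat m.+1 \o q)) *
    'D_v q).
  have qk0 := Ck_on_prev qk1.
  apply: (Ck_onM oU _ (qk v)).
  apply: (Ck_onD (V := R^o) oU); first exact: IH.
  by apply: Ck_onM => //; [exact: Ck_on_cst | exact: IH].
apply: Ck_on_ext H => // x Ux.
have qdx := qd x Ux; set a := _ x.
rewrite [RHS]deriveE; last exact: differentiable_comp.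
rewrite diff_comp//= -(deriveE v qdx) -deriveE// {}/a !fctE.
have -> : 'D_('D_v q x) (flat m) (q x) = 'D_v q x * 'D_1 (flat m) (q x).
  rewrite !deriveE// -[RHS]/(_ *: _) -linearZ/=; congr ('d _ _ _).
  by rewrite /GRing.scale/= mulr1.
have [_ ->] := is_derive_flat m (q x).
by rewrite mulNr mulrC.
Qed.

End Flat.

(** * Integration over the unit interval *)

Section Integral.
Context {R : realType}.
Local Notation mu := (@lebesgue_measure R).

Definition integral01 (f : R -> R) : R := \int[mu]_(t in `[0, 1]) f t.

Lemma integrable01 (f : R -> R) :
  continuous f -> mu.-integrable `[0, 1] (EFin \o f).
Proof.
move=> fc; apply: continuous_compact_integrable; first exact: segment_compact.
exact: continuous_subspaceT.
Qed.

Lemma integral01D (f h : R -> R) : continuous f -> continuous h ->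
  integral01 (f + h) = integral01 f + integral01 h.
Proof. by move=> fc hc; apply: RintegralD => //; exact: integrable01. Qed.

Lemma integral01Z (c : R) (f : R -> R) : continuous f ->
  integral01 (c *: f) = c * integral01 f.
Proof. by move=> fc; apply: RintegralZl => //; exact: integrable01. Qed.

Lemma continuousZr (c : R) (f : R -> R) : continuous f -> continuous (c *: f).
Proof. by move=> fc t; apply: cvgM; [exact: cvg_cst | exact: fc]. Qed.

Lemma continuous_sumr (I : Type) (s : seq I) (f : I -> R -> R) :
  (forall i, continuous (f i)) -> continuous (\sum_(i <- s) f i).
Proof.
move=> fc; elim/big_ind : _ => [|g h gc hc|//]; first exact: cst_continuous.
by move=> t; apply: continuousD; [exact: gc | exact: hc].
Qed.

Lemma integral01_sum (I : Type) (s : seq I) (f : I -> R -> R) :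
  (forall i, continuous (f i)) ->
  integral01 (\sum_(i <- s) f i) = \sum_(i <- s) integral01 (f i).
Proof.
move=> fc; elim: s => [|i s IH].
  by rewrite !big_nil /integral01 Rintegral_cst// mul0r.
by rewrite !big_cons integral01D ?IH//; exact: continuous_sumr.
Qed.

Lemma integral01_le (e : R) (f : R -> R) : continuous f ->
  (forall t, 0 <= t <= 1 -> `|f t| <= e) -> `|integral01 f| <= e.
Proof.
move=> fc fe.
apply: le_trans (le_normr_Rintegral _ (integrable01 fc)) _ => //.
have : \int[mu]_(x in `[0, 1]) cst e x = e.
  rewrite Rintegral_cst//= lebesgue_measure_itv/= lte_fin ltr01 -EFinD/=.
  by rewrite oppr0 addr0 mulr1.
move=> E; rewrite -[leRHS]E; apply: le_Rintegral => //.
- apply: integrable01 => t.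
  by apply: continuous_comp; [exact: fc | exact: norm_continuous].
- by apply: integrable01; exact: cst_continuous.
Qed.

Lemma integral01_derive (f df : R -> R) : continuous df ->
  (forall t, is_derive (t : R) (1 : R) f (df t)) -> integral01 df = f 1 - f 0.
Proof.
move=> dfc fdf.
have fc : continuous f.
  by move=> t; apply/differentiable_continuous/derivable1_diffP; case: (fdf t).
rewrite /integral01 /Rintegral (@continuous_FTC2 _ df f)//.
- exact: continuous_subspaceT.
- split; first by move=> t _; case: (fdf t).
    exact: cvg_at_right_filter (fc 0).
  exact: cvg_at_left_filter (fc 1).
- by move=> t _; rewrite derive1E; case: (fdf t).
Qed.

End Integral.

(** * Hadamard's lemma *)

Section Hadamard.
Context {R : realType} {n : nat} (y0 : 'rV[R]_n).
Local Notation E := 'rV[R]_n.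
Implicit Types (x h v p : E) (t s e : R) (w : R -> R) (F : E -> R).

Definition ray (x : E) (t : R) : E := y0 + t *: (x - y0).

Lemma rayD x h t : ray (x + h) t = ray x t + t *: h.
Proof. by rewrite /ray addrAC scalerDr addrA. Qed.

Lemma ray_continuous x : continuous (ray x).
Proof.
move=> t; rewrite /ray; apply: cvgD; first exact: cvg_cst.
exact: scalel_continuous.
Qed.

(** A weighted mean of F over the segment from y0 to x. Differentiation in x
replaces w by t * w and F by a derivative, so the weight makes the class of
these functions stable. *)
Definition ray_integral (w : R -> R) (F : E -> R) (x : E) : R :=
  integral01 (fun t => w t * F (ray x t)).

(** The tube lemma: as [0, 1] is compact, continuity of F along the segment is
uniform in t. *)
Lemma ray_near F x e : continuous F -> 0 < e ->
  \forall h \near (0 : E), forall t, 0 <= t <= 1 ->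
    `|F (ray (x + h) t) - F (ray x t)| <= e.
Proof.
move=> Fc e0.
have /compact_near_coveringP/(_ _ (nbhs (0 : E))
   (fun h t => `|F (ray (x + h) t) - F (ray x t)| <= e)) :=
   @segment_compact R 0 1.
have H0 (t : R) : `[0, 1]%classic t -> \forall t' \near t & h \near (0 : E),
    `|F (ray (x + h) t') - F (ray x t')| <= e.
  move=> _.
  (* jointly continuous, with value 0 when h = 0 *)
  pose psi (z : R * E) : R := F (ray (x + z.2) z.1) - F (ray x z.1).
  have psi0 : psi (t, 0) = 0 by rewrite /psi /= addr0 subrr.
  have rc (f : R * E -> E) : continuous f ->
      continuous (fun z : R * E => ray (f z) z.1).
    move=> fc z; rewrite /ray; apply: cvgD; first exact: cvg_cst.
    apply: cvgZ; first exact: cvg_fst.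
    by apply: cvgB; [exact: fc | exact: cvg_cst].
  have psic : psi @ (t, 0 : E) --> (0 : R).
    rewrite -psi0; apply: continuousB.
      apply: (@continuous_comp _ _ _ (fun z : R * E => ray (x + z.2) z.1) F).
        apply: (rc (fun z => x + z.2)) => z.
        by apply: cvgD; [exact: cvg_cst | exact: cvg_snd].
      exact: Fc.
    apply: (@continuous_comp _ _ _ (fun z : R * E => ray x z.1) F).
      exact/(rc (fun=> x))/cst_continuous.
    exact: Fc.
  by move/cvgr0Pnorm_le: psic => /(_ e e0).
move=> /(_ _ H0); apply: filterS => h Hh t t01.
by apply: Hh; rewrite /= in_itv.
Qed.

Lemma derive_coord F x v : differentiable F x ->
  'D_v F x = \sum_i v 0 i * 'D_(delta_mx 0 i) F x.
Proof.
move=> Fd; rewrite deriveE// [in LHS](row_sum_delta v) linear_sum.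
by apply: eq_bigr => i _; rewrite linearZ/= -deriveE.
Qed.

Lemma is_derive_line F p v (s : R) :
  differentiable F (p + s *: v) ->
  is_derive s (1 : R) (fun s : R => F (p + s *: v)) ('D_v F (p + s *: v)).
Proof.
move=> Fd; pose l (s : R) := p + s *: v.
have dl : is_diff s l (fun s : R => s *: v).
  have : is_diff s (cst p + (fun s : R => s *: v)) (0 + (fun s : R => s *: v)).
    exact: is_diffD.
  by rewrite add0r.
have Fl : differentiable (F \o l) s.
  by apply: differentiable_comp; [case: dl | exact: Fd].
split; first exact/derivable1_diffP.
rewrite -/(F \o l) deriveE// diff_comp//.
by rewrite /= diff_val /= scale1r deriveE.
Qed.

Lemma mean_value_line F p v :
  (forall x, differentiable F x) ->
  exists2 s : R, 0 <= s <= 1 & F (p + v) - F p = 'D_v F (p + s *: v).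
Proof.
move=> Fd.
have dF (s : R) := is_derive_line (Fd (p + s *: v)).
have [] := MVT_segment (@ler01 R) (fun s _ => dF s).
  apply: continuous_subspaceT => s.
  by apply/differentiable_continuous/derivable1_diffP; case: (dF s).
move=> s; rewrite in_itv /= => s01.
by rewrite scale1r scale0r addr0 subr0 mulr1; exists s.
Qed.

(** The mean value theorem turns the increment into a derivative at a point of
the segment of x + s h for some s in [0, 1], to which [ray_near] applies, with
an error uniform in t. *)
Lemma ray_expansion F x e : (forall x, differentiable F x) ->
  (forall v, continuous ('D_v F)) -> 0 < e ->
  \forall h \near (0 : E), forall t, 0 <= t <= 1 ->
    `|F (ray (x + h) t) - F (ray x t) -
      \sum_i h 0 i * (t * 'D_(delta_mx 0 i) F (ray x t))| <= e * `|h|.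
Proof.
move=> Fd Fc e0.
have e1 : 0 < e / n.+1%:R by rewrite divr_gt0.
have /nbhs_ballP[d /= d0 Hd] : \forall h \near (0 : E), forall (i : 'I_n) t,
    0 <= t <= 1 -> `|'D_(delta_mx 0 i) F (ray (x + h) t) -
      'D_(delta_mx 0 i) F (ray x t)| <= e / n.+1%:R.
  apply: (@filter_forall _ _ _ (nbhs (0 : E))) => i.
  exact: ray_near (Fc _) e1.
have hd0 : \forall h \near (0 : E), `|h| < d by exact: nbhs0_lt.
near=> h => t t01; have hd : `|h| < d by near: h.
rewrite rayD.
have [s s01 ->] := mean_value_line (ray x t) (t *: h) Fd.
rewrite derive_coord// -sumrB.
apply: le_trans (ler_norm_sum _ _ _) _.
have : forall i : 'I_n, true ->
  `|(t *: h) 0 i * 'D_(delta_mx 0 i) F (ray x t + s *: (t *: h)) -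
   h 0 i * (t * 'D_(delta_mx 0 i) F (ray x t))| <= (e / n.+1%:R) * `|h|.
  move=> i _; rewrite mxE scalerA [s * t]mulrC -scalerA -rayD.
  rewrite [t * h 0 i]mulrC -[h 0 i * t * _]mulrA -mulrBr -mulrBr.
  rewrite 2!normrM mulrC ler_pM ?mulr_ge0 ?coord_le_norm//.
  case/andP: (t01) => t0 t1; rewrite (ger0_norm t0).
  apply: le_trans (ler_piMl _ t1) _ => //.
  apply: Hd t01; rewrite -ball_normE /= sub0r normrN normrZ.
  case/andP: s01 => s0 s1; rewrite (ger0_norm s0).
  by apply: le_lt_trans (ler_piMl _ s1) hd.
move=> {}H; apply: le_trans (ler_sum _ H) _.
rewrite sumr_const card_ord -mulrnAl ler_wpM2r//.
rewrite -mulr_natr mulrAC -mulrA ler_piMr ?(ltW e0)// ler_pdivrMr ?ltr0n//.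
by rewrite mul1r ler_nat.
Unshelve. all: by end_near. Qed.

(** The bound 1 is stable under multiplication by t and lets estimates on F pass
to the mean without a constant. *)
Definition weight (w : R -> R) :=
  continuous w /\ forall t, 0 <= t <= 1 -> `|w t| <= 1.

Lemma weightM w : weight w -> weight (fun t => t * w t).
Proof.
move=> [wc w1]; split=> [t|t t01].
  by apply: cvgM; [exact: cvg_id | exact: wc].
case/andP: (t01) => t0 t1; rewrite normrM (ger0_norm t0).
exact: mulr_ile1 (w1 t t01).
Qed.

Lemma ray_integrand_continuous w F x : continuous w ->
  continuous F -> continuous (fun t => w t * F (ray x t)).
Proof.
move=> wc Fc t; apply: continuousM; first exact: wc.
by apply: (@continuous_comp _ _ _ (ray x) F); [exact: ray_continuous|exact: Fc].
Qed.

Lemma ray_integral_continuous w F : weight w -> continuous F ->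
  continuous (ray_integral w F).
Proof.
move=> [wc w1] Fc x.
have FF : Filter (nbhs (x : E)) by exact: nbhs_filter.
suff H e : 0 < e -> \forall y \near (x : E),
    `|ray_integral w F x - ray_integral w F y| <= e.
  exact: (@cvgrPdist_le _ _ _ (nbhs (x : E)) FF _ _).2 H.
move=> e0.
suff : \forall h \near (0 : E),
    `|ray_integral w F x - ray_integral w F (h + x)| <= e.
  by rewrite [X in X -> _](near_shift x) /=; apply: filterS => y;
    rewrite /shift /= sub0r subrK.
near=> h.
have ic y := ray_integrand_continuous (x := y) wc Fc.
rewrite distrC /ray_integral [h + x]addrC -mulN1r -integral01Z//.
rewrite -integral01D//; last exact: continuousZr.
apply: integral01_le.
  by move=> t; apply: continuousD; [exact: ic | exact: continuousZr].
move=> t t01; rewrite !fctE /GRing.scale/= mulN1r -mulrBr normrM.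
apply: le_trans (ler_piMl _ (w1 t t01)) _ => //.
by move: t t01; near: h; exact: ray_near.
Unshelve. all: by end_near. Qed.

Lemma ray_integral_differentiable w F x : weight w ->
  (forall x, differentiable F x) -> (forall v, continuous ('D_v F)) ->
  differentiable (ray_integral w F) x /\
  forall v, 'D_v (ray_integral w F) x =
    ray_integral (fun t => t * w t) ('D_v F) x.
Proof.
move=> ww Fd dFc; have [wc w1] := ww; have [tc _] := weightM ww.
have Fc : continuous F by move=> y; exact/differentiable_continuous.
pose c (i : 'I_n) := ray_integral (fun t => t * w t) ('D_(delta_mx 0 i) F) x.
pose f1 h t := w t * F (ray (x + h) t).
pose f2 t := w t * F (ray x t).
pose f3 (i : 'I_n) t := t * w t * 'D_(delta_mx 0 i) F (ray x t).
have f1c h : continuous (f1 h).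
  exact: (ray_integrand_continuous (x := x + h) wc Fc).
have f2c : continuous f2 by exact: (ray_integrand_continuous (x := x) wc Fc).
have f3c i : continuous (f3 i).
  exact: (ray_integrand_continuous (x := x) tc (dFc _)).
have f3Zc h i : continuous ((- h 0 i) *: f3 i) by exact: continuousZr.
have f3sc h : continuous (\sum_i (- h 0 i) *: f3 i) by exact: continuous_sumr.
have f23c h : continuous ((-1 : R) *: f2 + \sum_i (- h 0 i) *: f3 i).
  by move=> t; apply: continuousD; [exact: continuousZr | exact: f3sc].
have [] := @differentiable_expansion R n (ray_integral w F) x c.
  move=> e e0.
  have H := ray_expansion x Fd dFc e0.
  near=> h.
  have -> : ray_integral w F (x + h) - ray_integral w F x - \sum_i h 0 i * c i =
    integral01 (f1 h + ((-1 : R) *: f2 + \sum_i (- h 0 i) *: f3 i)).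
    rewrite integral01D// integral01D//; last exact: continuousZr.
    rewrite integral01Z// integral01_sum// mulN1r addrA -sumrN.
    congr (_ + _); apply: eq_bigr => i _.
    by rewrite integral01Z// mulNr.
  apply: integral01_le => [t|t t01].
    by apply: continuousD; [exact: f1c | exact: f23c].
  have -> : (f1 h + ((-1 : R) *: f2 + \sum_i (- h 0 i) *: f3 i)) t =
     w t * (F (ray (x + h) t) - F (ray x t) -
      \sum_i h 0 i * (t * 'D_(delta_mx 0 i) F (ray x t))).
    rewrite -[LHS]/(f1 h t + (-1 * f2 t + (\sum_i (- h 0 i) *: f3 i) t)).
    rewrite fct_sumE mulN1r !mulrDr mulrN addrA mulrN.
    congr (_ + _); rewrite mulr_sumr -sumrN; apply: eq_bigr => i _.
    by rewrite /f3 /GRing.scale/= /GRing.scale/=; ring.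
  rewrite normrM; apply: le_trans (ler_piMl _ (w1 t t01)) _ => //.
  by move: t t01; near: h.
move=> Id De; split=> // v; rewrite De.
have -> : ray_integral (fun t => t * w t) ('D_v F) x =
    integral01 (\sum_i v 0 i *: f3 i).
  congr integral01; apply/funext => t.
  rewrite derive_coord// mulr_sumr fct_sumE.
  by apply: eq_bigr => i _; rewrite /f3 !fctE /GRing.scale/=; ring.
rewrite integral01_sum => [|i]; last exact: continuousZr.
by apply: eq_bigr => i _; rewrite integral01Z.
Unshelve. all: by end_near. Qed.

Lemma Ck_on_ray_integral k w F : weight w -> Ck_on k setT F ->
  Ck_on k setT (ray_integral w F).
Proof.
elim: k w F => [|k IH] w F ww.
  by move=> Fc x _; apply: ray_integral_continuous => // y; exact: Fc.
move=> [Fd Fk].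
have Fd' x : differentiable F x by exact: Fd.
have Fc v : continuous ('D_v F) by move=> x; exact: Ck_on_continuous (Fk v) x I.
split=> [x _|v]; first by have [] := ray_integral_differentiable x ww Fd' Fc.
apply: Ck_on_ext openT _ (IH _ _ (weightM ww) (Fk v)) => x _.
by have [_ ->] := ray_integral_differentiable x ww Fd' Fc.
Qed.

(** F x - F y0 is the integral of the derivative of t |-> F (y0 + t (x - y0)), a
combination of partial derivatives in which the factors x_i - y0_i do not
depend on t. *)
Lemma hadamard F : smooth_on setT F ->
  exists2 G : 'I_n -> E -> R, (forall i, smooth_on setT (G i)) &
    forall x, F x = F y0 + \sum_i (x - y0) 0 i * G i x.
Proof.
move=> Fs; have [Fd Fk] := Fs 1.
have w1 : weight (cst 1).
  by split=> [|t _]; [exact: cst_continuous | rewrite normr1].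
exists (fun i => ray_integral (cst 1) ('D_(delta_mx 0 i) F)).
  by move=> i k; apply: Ck_on_ray_integral => //; have [_] := Fs k.+1; exact.
move=> x; rewrite -[F x](subrK (F y0)) addrC; congr (_ + _).
have dF t := is_derive_line (Fd (y0 + t *: (x - y0)) I).
have dFc v : continuous ('D_v F) by move=> y; exact: Fk v y I.
have := integral01_derive _ dF.
rewrite scale1r scale0r addr0 [y0 + _]addrC subrK => <-.
  have -> : (fun t => 'D_(x - y0) F (y0 + t *: (x - y0))) =
      \sum_i (x - y0) 0 i *: (fun t => cst 1 t * 'D_(delta_mx 0 i) F (ray x t)).
    apply/funext => t; rewrite derive_coord ?fct_sumE; last exact: Fd.
    by apply: eq_bigr => i _; rewrite fctE /GRing.scale/= mul1r.
  rewrite integral01_sum => [|i].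
    apply: eq_bigr => i _; rewrite integral01Z//.
    exact: (ray_integrand_continuous (x := x) w1.1 (dFc _)).
  apply: continuousZr.
  exact: (ray_integrand_continuous (x := x) w1.1 (dFc _)).
move=> t; apply: (@continuous_comp _ _ _ (ray x) ('D_(x - y0) F)).
  exact: ray_continuous.
exact: dFc.
Qed.

End Hadamard.

(** * Bump functions and extension from a chart *)

Section Bump.
Context {R : realType} {n : nat}.
Local Notation E := 'rV[R]_n.

Lemma Ck_on_id k (U : set E) : Ck_on k U (id : E -> E).
Proof.
case: k => [|k]; first by move=> x _; exact: cvg_id.
split=> [x _|v]; first by have [] := is_diff_id x.
have -> : 'D_v (id : E -> E) = cst v by apply/funext => x; exact: derive_id.
exact: Ck_on_cst.
Qed.

Lemma Ck_on_coord_sub k (U : set E) (y0 : E) (i : 'I_n) : open U ->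
  Ck_on k U (fun y => (y - y0) 0 i).
Proof.
move=> oU; apply: Ck_on_coord => //.
exact: (Ck_onD oU (Ck_on_id k U) (Ck_on_cst k U (- y0))).
Qed.

Lemma derive_coord_sub (y0 x v : E) (i : 'I_n) :
  'D_v (fun y : E => (y - y0) 0 i) x = v 0 i.
Proof.
have d : is_derive x v (fun y : E => y - y0) (v - 0).
  exact: (is_deriveB (f := id) (g := cst y0)).
have [/derive_mx + H] := d; rewrite H subr0 => /(congr1 (fun A : E => A 0 i)).
by rewrite mxE.
Qed.

(** The function is flat 0 (s^2 - |y - y0|^2), normalised at y0, for the
Euclidean norm, whose square is a polynomial; it dominates the maximum norm of
row vectors, so the Euclidean ball K lies in a ball contained in U. *)
Lemma exists_bump (U : set E) (y0 : E) : open U -> U y0 ->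
  exists (b : E -> R) (K : set E), [/\ smooth_on setT b, compact K, K `<=` U,
    (forall y, ~ K y -> b y = 0) & b y0 = 1].
Proof.
move=> oU Uy0.
have /nbhs_ballP[r /= r0 rU] : nbhs y0 U by exact: open_nbhs_nbhs.
pose s := r / 2.
have s0 : 0 < s by rewrite divr_gt0.
pose co i (y : E) : R := (y - y0) 0 i.
pose q : E -> R := \sum_i (co i * co i).
have qE y : q y = \sum_i (y - y0) 0 i ^+ 2 by rewrite /q fct_sumE.
have qk k : Ck_on k setT q.
  apply: Ck_on_sum openT _ => i.
  by apply: Ck_onM openT _ _; exact: Ck_on_coord_sub openT.
pose K := [set y | q y <= s ^+ 2].
have Kball y : K y -> `|y - y0| <= s.
  rewrite /K /= qE => qs; rewrite [leLHS]/Num.norm /= mx_normrE.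
  apply/bigmax_leP; split=> [|[i j] _ /=]; first exact: ltW.
  rewrite ord1 -ler_sqr ?nnegrE ?(ltW s0)// real_normK ?num_real//.
  apply: le_trans qs; rewrite (bigD1 j)//= lerDl sumr_ge0// => l _.
  exact: sqr_ge0.
exists (cst (flat 0 (s ^+ 2))^-1 * (flat 0 \o (cst (s ^+ 2) - q))), K; split.
- move=> k; apply: Ck_onM openT (Ck_on_cst _ _ _) _.
  apply: Ck_on_flat_comp openT _.
  have -> : cst (s ^+ 2) - q = cst (s ^+ 2) + cst (-1) * q :> (E -> R).
    by apply/funext => y; rewrite !fctE mulN1r.
  apply: (Ck_onD (V := R^o) openT (Ck_on_cst _ _ _)).
  exact: Ck_onM openT (Ck_on_cst _ _ _) (qk k).
- apply: bounded_closed_compact.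
    exists (`|y0| + s); split; first exact: num_real.
    move=> M Ms y Ky; have := Kball y Ky; have := ler_normD (y - y0) y0.
    by rewrite subrK => ? ?; rewrite /globally /=; lra.
  apply: (@closed_comp _ _ q [set t | t <= s ^+ 2]); last exact: closed_le.
  by move=> y _; exact: qk 0%N y I.
- move=> y /Kball ys; apply: rU; rewrite -ball_normE /= distrC.
  by apply: le_lt_trans ys _; rewrite /s; lra.
- move=> y /negP; rewrite -ltNge => qs.
  rewrite -[LHS]/((flat 0 (s ^+ 2))^-1 * flat 0 (s ^+ 2 - q y)).
  by rewrite [flat _ (_ - _)]/flat ltNge subr_le0 (ltW qs) /= mulr0.
- rewrite -[LHS]/((flat 0 (s ^+ 2))^-1 * flat 0 (s ^+ 2 - q y0)) qE subrr.
  rewrite big1 => [|i _]; last by rewrite mxE expr0n.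
  rewrite subr0 mulVf// /flat exprn_gt0// gt_eqF// expr0 mul1r.
  exact: expR_gt0.
Qed.

End Bump.

Section ChartExtension.
Context {R : realType} {n : nat} (M : smooth_manifold R n).
Local Notation E := 'rV[R]_n.

Lemma chart_invP (c : chart R n M) y : chart_img c y ->
  chart_dom c (chart_inv c y) /\ c (chart_inv c y) = y.
Proof. by move=> [q dq <-]; rewrite chart_mapK. Qed.

Lemma open_chart_imgI (c : chart R n M) (A : set M) : open A ->
  open (c @` (chart_dom c `&` A)).
Proof.
move=> oA; rewrite openE => _ [q [dq Aq] <-].
have H1 : \forall y \near c q, chart_img c y.
  by apply: open_nbhs_nbhs; split; [exact: open_chart_img | exists q].
have H2 : \forall y \near c q, A (chart_inv c y).
  apply: (@chart_inv_continuous R n M c (c q)); first by exists q.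
  by rewrite /= chart_mapK//; exact: open_nbhs_nbhs.
rewrite /interior /=.
apply: filterS2 H1 H2 => y cy Ay; have [d e] := chart_invP cy.
by exists (chart_inv c y).
Qed.

Variables (c : chart R n M) (Mc : atlas M c).

Definition extend_by0 (H : E -> R) (q : M) : R :=
  if q \in chart_dom c then H (c q) else 0.

Lemma extend_by0E H q : chart_dom c q -> extend_by0 H q = H (c q).
Proof. by rewrite /extend_by0 => dq; rewrite ifT ?inE. Qed.

(** On the domain of c the extension is H composed with a change of charts. Any
other point avoids the preimage of K, which is compact, hence closed since M is
Hausdorff, and the extension vanishes around that point. *)
Lemma extend_by0_smooth (H : E -> R) (K : set E) :
  smooth_on (chart_img c) H -> compact K -> K `<=` chart_img c ->
  (forall y, ~ K y -> H y = 0) -> extend_by0 H \in smooth_fun M.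
Proof.
move=> Hs cK KU H0; apply/smooth_funP => c' Mc' k.
apply: Ck_on_local => _ [q dq <-].
have [cq|ncq] := pselect (chart_dom c q).
  exists (c' @` (chart_dom c' `&` chart_dom c)), (H \o (c \o chart_inv c')).
    split; [exact/open_chart_imgI/open_chart_dom|by exists q|].
    apply: (Ck_on_comp (V := chart_img c)) (Hs k).
    - exact/open_chart_imgI/open_chart_dom.
    - by move=> _ [r [dr cr] <-] /=; rewrite chart_mapK//; exists r.
    - exact: (atlas_compatible Mc' Mc).
  by move=> _ [r [dr cr] <-] /=; rewrite chart_mapK// extend_by0E.
pose K' := chart_inv c @` K.
have clK' : closed K'.
  apply: compact_closed; first exact: manifold_hausdorff.
  apply: continuous_compact cK.
  apply: continuous_in_subspaceT => y /[!inE] Ky.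
  exact/chart_inv_continuous/KU.
exists (c' @` (chart_dom c' `&` ~` K')), (cst 0).
  split; [|exists q => //|exact: Ck_on_cst].
    exact/open_chart_imgI/closed_openC.
  split=> // -[y /KU cy yq].
  by apply: ncq; rewrite -yq; have [] := chart_invP cy.
move=> _ [r [dr nr] <-] /=; rewrite chart_mapK// /extend_by0.
case: ifPn => // /[!inE] cr; rewrite H0// => Kr; apply: nr.
by exists (c r) => //; rewrite chart_mapK.
Qed.

Lemma Ck_on_supported k (H : E -> R) (U K : set E) : open U ->
  Ck_on k U H -> closed K -> K `<=` U -> (forall y, ~ K y -> H y = 0) ->
  Ck_on k setT H.
Proof.
move=> oU Hk clK KU H0; apply: Ck_on_local => y _.
have [Ky|nKy] := pselect (K y).
  by exists U, H => //; split=> //; exact: KU.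
exists (~` K), (cst 0); last by move=> z nK; rewrite H0.
by split=> //; [exact: closed_openC | exact: Ck_on_cst].
Qed.

End ChartExtension.

(** * Curvature of torsion dual metric connections *)

Lemma addrDBB (V : zmodType) (a a' b b' c c' : V) :
  a + a' - (b + b') - (c + c') = (a - b - c) + (a' - b' - c').
Proof. by rewrite !opprD [RHS]addrACA [in RHS](addrACA a). Qed.

Section VectorFields.
Context {R : realType} {n : nat} (M : smooth_manifold R n).
Implicit Types (X Y Z W : vector_field M) (p : M).

Lemma vector_field_eqP X Y :
  (forall f q, (X f : Cinf M) q = (Y f : Cinf M) q) -> X = Y.
Proof.
by move=> XY; apply/val_inj/funext => f; apply/Cinf_eqP => q; exact: XY.
Qed.

Lemma vector_field0 X p : (X 0 : Cinf M) p = 0.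
Proof.
have /derivationP[Xl _] := vf_derivation X.
by have := Xl 1 0 0 p; rewrite scaler0 addr0 mul1r; lra.
Qed.

Lemma vector_fieldD X f h p :
  (X (f + h) : Cinf M) p = (X f : Cinf M) p + (X h : Cinf M) p.
Proof.
have /derivationP[Xl _] := vf_derivation X.
by have := Xl 1 f h p; rewrite scale1r => ->; ring.
Qed.

Lemma lie_bracketE X Y f p :
  (lie_bracket X Y f : Cinf M) p = (X (Y f) : Cinf M) p - (Y (X f) : Cinf M) p.
Proof. by []. Qed.

Lemma lie_bracket_skew X Y : lie_bracket Y X = - lie_bracket X Y.
Proof.
apply: vector_field_eqP => f q.
by rewrite -[RHS]/(- (lie_bracket X Y f : Cinf M) q) !lie_bracketE opprB.
Qed.

Lemma lie_bracketDl X Y Z :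
  lie_bracket (X + Y) Z = lie_bracket X Z + lie_bracket Y Z.
Proof.
apply: vector_field_eqP => f q.
rewrite -[RHS]/((lie_bracket X Z f : Cinf M) q +
  (lie_bracket Y Z f : Cinf M) q).
rewrite !lie_bracketE.
rewrite -[((X + Y) (Z f) : Cinf M) q]/((X (Z f) : Cinf M) q +
  (Y (Z f) : Cinf M) q).
by rewrite vector_fieldD; ring.
Qed.

Lemma lie_bracketDr X Y Z :
  lie_bracket Z (X + Y) = lie_bracket Z X + lie_bracket Z Y.
Proof. by rewrite lie_bracket_skew lie_bracketDl opprD -!lie_bracket_skew. Qed.

Lemma vf_atD X Y p : vf_at (X + Y) p = vf_at X p + vf_at Y p.
Proof. exact/val_inj. Qed.

Section Metric.
Variable g : riemannian_metric M.

Lemma metric_atDl p (u v w : tangent p) :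
  metric_at g (u + v) w = metric_at g u w + metric_at g v w.
Proof. by have := metric_linearl g 1 u v w; rewrite scale1r mul1r. Qed.

Lemma metric_vfC X Y : metric_vf g X Y = metric_vf g Y X.
Proof. by apply/Cinf_eqP => p; rewrite /= (Defs.metric_sym g). Qed.

Lemma metric_vfDl X Y Z p :
  metric_vf g (X + Y) Z p = metric_vf g X Z p + metric_vf g Y Z p.
Proof. by rewrite /= vf_atD metric_atDl. Qed.

Lemma metric_vf0l Z p : metric_vf g 0 Z p = 0.
Proof. by have := metric_vfDl 0 0 Z p; rewrite addr0; lra. Qed.

Lemma metric_vfNl X Z p : metric_vf g (- X) Z p = - metric_vf g X Z p.
Proof. by have := metric_vfDl X (- X) Z p; rewrite subrr metric_vf0l; lra. Qed.

Lemma metric_vfBl X Y Z p :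
  metric_vf g (X - Y) Z p = metric_vf g X Z p - metric_vf g Y Z p.
Proof. by rewrite metric_vfDl metric_vfNl. Qed.

Lemma metric_vfDr X Y Z p :
  metric_vf g Z (X + Y) p = metric_vf g Z X p + metric_vf g Z Y p.
Proof. by rewrite metric_vfC metric_vfDl ![metric_vf g _ Z]metric_vfC. Qed.

Lemma metric_vfNr X Z p : metric_vf g Z (- X) p = - metric_vf g Z X p.
Proof. by rewrite metric_vfC metric_vfNl metric_vfC. Qed.

End Metric.

Section Connection.
Variable D : affine_connection M.

Lemma nablaDl X Y Z : D (X + Y) Z = D X Z + D Y Z.
Proof. by have := nabla_linearl D 1 X Y Z; rewrite !scale1r. Qed.

Lemma nabla0r X : D X 0 = 0.
Proof. by apply/(addIr (D X 0)); rewrite -nabla_addr !add0r. Qed.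

Lemma curvatureDX X X' Y Z :
  curvature D (X + X') Y Z = curvature D X Y Z + curvature D X' Y Z.
Proof.
rewrite /curvature lie_bracketDl !nablaDl nabla_addr.
exact: addrDBB.
Qed.

Lemma curvatureDY X Y Y' Z :
  curvature D X (Y + Y') Z = curvature D X Y Z + curvature D X Y' Z.
Proof.
rewrite /curvature lie_bracketDr !nablaDl nabla_addr.
exact: addrDBB.
Qed.

Lemma curvatureDZ X Y Z Z' :
  curvature D X Y (Z + Z') = curvature D X Y Z + curvature D X Y Z'.
Proof.
rewrite /curvature !nabla_addr.
exact: addrDBB.
Qed.

End Connection.

Section TorsionDual.
Variables (g : riemannian_metric M) (D D' : affine_connection M).
Hypotheses (DD' : is_torsion_dual D D') (Dg : is_metric_connection D g)
  (D'g : is_metric_connection D' g).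

Lemma torsion_dualE X Y : D X Y = D' Y X + lie_bracket X Y.
Proof. by apply/eqP; rewrite -subr_eq0 opprD addrA DD'. Qed.

Lemma metric_connectionE (C : affine_connection M) X Y Z p :
  is_metric_connection C g ->
  (X (metric_vf g Y Z) : Cinf M) p =
  metric_vf g (C X Y) Z p + metric_vf g (C X Z) Y p.
Proof.
move=> Cg; have := congr1 (fun f : Cinf M => f p) (Cg X Y Z).
rewrite /nabla_metric [metric_vf g Y (C X Z)]metric_vfC.
set a := X _; set b := metric_vf g _ Z; set c := metric_vf g _ Y.
rewrite -[(a - b - c) p]/(a p - b p - c p) -[(0 : Cinf M) p]/(0 : R).
by move/eqP; rewrite subr_eq0 subr_eq => /eqP ->; rewrite addrC.
Qed.

(** Under [is_torsion_dual] this is the torsion D X Y - D Y X - [X, Y] of D. *)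
Definition torsion X Y := D X Y - D' X Y.
Local Notation tau X Y Z p := (metric_vf g (torsion X Y) Z p).

Lemma torsionE X Y : D X Y = D' X Y + torsion X Y.
Proof. by rewrite /torsion addrC subrK. Qed.

Lemma torsion_skew X Y : torsion Y X = - torsion X Y.
Proof.
rewrite /torsion !torsion_dualE (lie_bracket_skew X Y) opprB opprD addrA.
by rewrite addrAC.
Qed.

Lemma torsion_form_skew12 X Y Z p : tau Y X Z p = - tau X Y Z p.
Proof. by rewrite torsion_skew metric_vfNl. Qed.

(** Both connections compute the derivative X (g(Y,Z)); the difference of the
two results is g(T(X,Y),Z) + g(Y,T(X,Z)). *)
Lemma torsion_form_skew23 X Y Z p : tau X Z Y p = - tau X Y Z p.
Proof.
have := metric_connectionE X Y Z p Dg; have := metric_connectionE X Y Z p D'g.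
by rewrite !metric_vfBl; lra.
Qed.

Lemma torsionxx X : torsion X X = 0.
Proof.
rewrite /torsion torsion_dualE addrC addKr.
by apply: vector_field_eqP => f q; rewrite lie_bracketE subrr.
Qed.

(** The derivative of the torsion enters only through g(D_Y (T(X,Y)), X). As
g(T(X,Y),X) = 0, metricity trades it for - g(T(X,Y), D_Y X), and the remaining
terms are algebraic in the 3-form. *)
Lemma sectional_curvature_eq X Y p :
  metric_vf g (curvature D X Y Y) X p = metric_vf g (curvature D' X Y Y) X p.
Proof.
have HX A : tau X A X p = 0.
  have := torsion_form_skew12 X X A p; have := torsion_form_skew23 X X A p.
  by lra.
have cyc A B : tau A Y B p = tau Y B A p.
  by rewrite torsion_form_skew12 torsion_form_skew23; lra.
have cyc' A : tau Y A X p = tau X Y A p.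
  by rewrite torsion_form_skew23 torsion_form_skew12; lra.
have E1 : D X (D Y Y) = D' X (D' Y Y) + torsion X (D' Y Y).
  by rewrite -torsionE [D Y Y]torsionE torsionxx addr0.
have E2 : D Y (D X Y) = D' Y (D' X Y) + torsion Y (D' X Y) + D Y (torsion X Y).
  by rewrite -torsionE -nabla_addr -torsionE.
have E3 := torsionE (lie_bracket X Y) Y.
have E4 : metric_vf g (torsion X Y) X = 0.
  apply/Cinf_eqP => q; rewrite -[RHS]/(0:R).
  have := torsion_form_skew12 X X Y q; have := torsion_form_skew23 X X Y q; lra.
have E5 := metric_connectionE Y (torsion X Y) X p Dg.
rewrite E4 vector_field0 in E5.
have E6 : tau X Y (D Y X) p = tau X Y (D' X Y) p - tau X Y (lie_bracket X Y) p.
  rewrite [D Y X]torsion_dualE metric_vfDr (lie_bracket_skew X Y).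
  by rewrite metric_vfNr.
rewrite /curvature !metric_vfBl E1 E2 E3.
rewrite (metric_vfDl g _ (torsion X _)) (metric_vfDl g _ (D Y (torsion X Y))).
rewrite (metric_vfDl g _ (torsion Y _)).
rewrite (metric_vfDl g _ (torsion (lie_bracket X Y) _)).
rewrite HX.
have := cyc' (D' X Y); have := cyc (lie_bracket X Y) X.
have := cyc' (lie_bracket X Y).
rewrite [metric_vf g (D Y X) _]metric_vfC in E5.
have := torsion_form_skew23 Y X (lie_bracket X Y) p.
have := torsion_form_skew12 X Y (lie_bracket X Y) p.
lra.
Qed.

(** The tensor R - R' with its upper index lowered. *)
Definition curvature_gap X Y Z W p :=
  metric_vf g (curvature D X Y Z) W p - metric_vf g (curvature D' X Y Z) W p.

(** The gap is additive in each argument and vanishes on (A, B, B, A); replace B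
by Y + Z, then A by X + W. *)
Lemma curvature_gap_polarized X Y Z W p :
  curvature_gap X Y Z W p + curvature_gap W Y Z X p +
  (curvature_gap X Z Y W p + curvature_gap W Z Y X p) = 0.
Proof.
have S0 A B : curvature_gap A B B A p = 0.
  by rewrite /curvature_gap sectional_curvature_eq subrr.
have SD1 A A' B C E : curvature_gap (A + A') B C E p =
    curvature_gap A B C E p + curvature_gap A' B C E p.
  by rewrite /curvature_gap !curvatureDX !metric_vfDl; lra.
have SD2 A B B' C E : curvature_gap A (B + B') C E p =
    curvature_gap A B C E p + curvature_gap A B' C E p.
  by rewrite /curvature_gap !curvatureDY !metric_vfDl; lra.
have SD3 A B C C' E : curvature_gap A B (C + C') E p =
    curvature_gap A B C E p + curvature_gap A B C' E p.
  by rewrite /curvature_gap !curvatureDZ !metric_vfDl; lra.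
have SD4 A B C E E' : curvature_gap A B C (E + E') p =
    curvature_gap A B C E p + curvature_gap A B C E' p.
  by rewrite /curvature_gap !metric_vfDr; lra.
have S1 A : curvature_gap A Y Z A p + curvature_gap A Z Y A p = 0.
  have := S0 A (Y + Z); rewrite SD2 !SD3 !S0; lra.
have := S1 (X + W); have := S1 X; have := S1 W.
rewrite !SD1 !SD4; lra.
Qed.

End TorsionDual.
End VectorFields.

(** * The coordinate frame of a tangent space *)

Section ChartCoordinates.
Context {R : realType} {n : nat} (M : smooth_manifold R n).
Local Notation E := 'rV[R]_n.

Lemma tangent_linear (p : M) (w : tangent p) (a : R) (f h : Cinf M) :
  w (a *: f + h) = a * w f + w h.
Proof. by have /asboolP[H _] := tangent_derivation w; exact: H. Qed.

Lemma tangentM (p : M) (w : tangent p) (f h : Cinf M) :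
  w (f * h) = w f * h p + f p * w h.
Proof. by have /asboolP[_ H] := tangent_derivation w; exact: H. Qed.

Lemma tangentD (p : M) (w : tangent p) (f h : Cinf M) : w (f + h) = w f + w h.
Proof. by have := tangent_linear w 1 f h; rewrite scale1r mul1r. Qed.

Lemma tangent0 (p : M) (w : tangent p) : w 0 = 0.
Proof. by have := tangentD w 0 0; rewrite addr0; lra. Qed.

Lemma tangentZ (p : M) (w : tangent p) a (f : Cinf M) : w (a *: f) = a * w f.
Proof. by have := tangent_linear w a f 0; rewrite tangent0 !addr0. Qed.

Lemma tangent1 (p : M) (w : tangent p) : w 1 = 0.
Proof.
by have := tangentM w 1 1; rewrite mulr1 -[(1 : Cinf M) p]/(1 : R); lra.
Qed.

Lemma tangent_sum (p : M) (w : tangent p) (f : 'I_n -> Cinf M) :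
  w (\sum_i f i) = \sum_i w (f i).
Proof. exact: (big_morph w (tangentD w) (tangent0 w)). Qed.

Lemma Cinf_sumE (f : 'I_n -> Cinf M) q : (\sum_i f i) q = \sum_i f i q.
Proof. exact: (big_morph (fun h : Cinf M => h q)). Qed.

(** The [xi i] are the coordinates centred at p times a bump function b with
b(p) = 1. Hadamard's lemma for b (f - f(p)), multiplied by b^2, is an identity
b^3 (f - f(p)) = sum_i xi_i (b G_i) between global functions. Both f - f(p) and
xi_i vanish at p, so by the Leibniz rule a derivation w at p sends it to
w f = sum_i w(xi_i) G_i(p), with coefficients independent of w. *)
Lemma chart_coordinates (c : chart R n M) (p : M) :
  atlas M c -> chart_dom c p ->
  exists xi : 'I_n -> Cinf M,
    (forall i v, 'D_v (xi i \o chart_inv c) (c p) = v 0 i) /\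
    forall f : Cinf M, exists a : 'I_n -> R,
      forall w : tangent p, w f = \sum_i w (xi i) * a i.
Proof.
move=> Mc dp; pose U := chart_img c; pose y0 : E := c p.
have Uy0 : U y0 by exists p.
have oU : open U := open_chart_img c.
have [b [K [bs cK KU b0 b1]]] := exists_bump oU Uy0.
have clK : closed K by apply: compact_closed cK; exact: norm_hausdorff.
have bH_smooth (H : E -> R) : smooth_on setT H ->
    extend_by0 c (b * H) \in smooth_fun M.
  move=> Hs; apply: (extend_by0_smooth Mc _ cK KU).
    move=> k; apply: (Ck_on_subset (U := setT)) => //.
    exact: Ck_onM openT (bs k) (Hs k).
  by move=> y nK; rewrite fctE b0// mul0r.
pose ext H (Hs : smooth_on setT H) : Cinf M := MkCinf (bH_smooth H Hs).
have extE H (Hs : smooth_on setT H) q : chart_dom c q ->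
    ext H Hs q = b (c q) * H (c q).
  by move=> dq; rewrite /= extend_by0E.
have ext0 H (Hs : smooth_on setT H) q : ~ chart_dom c q -> ext H Hs q = 0.
  by move=> dq; rewrite /= /extend_by0 ifF//; apply/negbTE/negP; rewrite inE.
have coord_smooth i : smooth_on setT (fun y : E => (y - y0) 0 i).
  by move=> k; exact: Ck_on_coord_sub openT.
pose xi i := ext _ (coord_smooth i).
have db : differentiable b y0 by have [+ _] := bs 1%N; exact.
exists xi; split=> [i v|f].
  have dc : differentiable (fun y : E => (y - y0) 0 i) y0.
    by have [+ _] := coord_smooth i 1%N; exact.
  (* b(y0) = 1 and the coordinate vanishes at y0: only one Leibniz term stays *)
  have -> : 'D_v (xi i \o chart_inv c) (c p) =
      'D_v (b * (fun y : E => (y - y0) 0 i)) y0.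
    apply: near_eq_derive.
    have : \forall y \near y0, U y by exact: open_nbhs_nbhs.
    apply: filterS => y Uy; have [dq cq] := chart_invP Uy.
    by rewrite /= extend_by0E// cq.
  rewrite deriveM; [|exact: diff_derivable..].
  by rewrite derive_coord_sub b1 subrr mxE scale0r addr0 scale1r.
(* zero off K, whatever chart_inv does outside the image of the chart *)
pose F y := b y * (f (chart_inv c y) - f p).
have Fs : smooth_on setT F.
  move=> k; apply: (Ck_on_supported oU _ clK KU).
    apply: (Ck_onM oU); first exact: Ck_on_subset (bs k).
    have /smooth_funP/(_ c Mc k) fk := Cinf_smooth f.
    exact: (Ck_onD oU fk (Ck_on_cst k _ (- f p))).
  by move=> y nK; rewrite /F b0// mul0r.
have [G Gs FG] := hadamard y0 Fs.
exists (fun i => G i y0) => w.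
have one_smooth : smooth_on setT (cst 1 : E -> R) by move=> k; exact: Ck_on_cst.
pose B := ext _ one_smooth.
have id3 : B * B * B * (f - (f p *: (1 : Cinf M) : Cinf M)) =
    \sum_i xi i * ext _ (Gs i).
  apply/Cinf_eqP => q; rewrite Cinf_sumE !CinfE -[(1 : Cinf M) q]/(1 : R).
  have [dq|ndq] := pselect (chart_dom c q); last first.
    rewrite (ext0 _ one_smooth)// !mul0r big1// => i _.
    by rewrite CinfE (ext0 _ (coord_smooth i))// mul0r.
  under eq_bigr => i _ do rewrite CinfE !extE//.
  rewrite !extE//.
  transitivity (b (c q) * b (c q) * F (c q)).
    rewrite /F chart_mapK// /cst; ring.
  rewrite FG {1}/F chart_mapK// subrr mulr0 add0r mulr_sumr.
  by apply: eq_bigr => i _; ring.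
have Bp : B p = 1 by rewrite extE// -/y0 b1 mul1r.
have := congr1 w id3; rewrite tangent_sum tangentM !CinfE Bp.
rewrite -[(1 : Cinf M) p]/(1 : R) mulr1 subrr mulr0 add0r !mul1r.
rewrite -scaleNr tangentD tangentZ tangent1 mulr0 addr0 => ->.
apply: eq_bigr => i _; rewrite tangentM !extE// -/y0 subrr mxE.
rewrite mulr0 mul0r addr0.
by rewrite b1 mul1r.
Qed.

End ChartCoordinates.

Section Contraction.
Context {R : realType} {n : nat} (M : smooth_manifold R n).
Variables (c : chart R n M) (p : M) (e : 'I_n -> tangent p).
Hypotheses (Mc : atlas M c) (cp : chart_dom c p).
Hypothesis e_coord : forall i (f : Cinf M),
  e i f = 'D_(delta_mx 0 i) (f \o chart_inv c) (c p).

Lemma tangent_sumE (a : 'I_n -> R) f :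
  (\sum_m a m *: e m) f = \sum_m a m * e m f.
Proof. exact: (big_morph (fun v : tangent p => v f)). Qed.

(** In w f = sum_i w(xi_i) a_i, the choice w = e_m identifies a_m with e_m f. *)
Lemma tangent_decomposition (v : tangent p) :
  exists a : 'rV[R]_n, v = \sum_m a 0 m *: e m.
Proof.
have [xi [xiE xif]] := chart_coordinates Mc cp.
exists (\row_i v (xi i)); apply/val_inj/funext => f.
rewrite -[LHS]/(v f) -[RHS]/((\sum_m (\row_i v (xi i)) 0 m *: e m) f).
have [a fa] := xif f; rewrite tangent_sumE fa; apply: eq_bigr => m _.
rewrite mxE; congr (_ * _); rewrite fa (bigD1 m)//= big1 ?addr0 => [|i im].
  by rewrite e_coord xiE mxE !eqxx mul1r.
by rewrite e_coord xiE mxE eqxx (negbTE im) mul0r.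
Qed.

Lemma tangent_free (a : 'rV[R]_n) : \sum_m a 0 m *: e m = 0 -> a = 0.
Proof.
have [xi [xiE xif]] := chart_coordinates Mc cp.
move=> a0; apply/rowP => i; rewrite mxE.
have : (\sum_m a 0 m *: e m) (xi i) = 0 by rewrite a0.
rewrite tangent_sumE (bigD1 i)//= big1 ?addr0 => [|j ji].
  by rewrite e_coord xiE mxE !eqxx mulr1.
by rewrite e_coord xiE mxE eqxx eq_sym (negbTE ji) mulr0.
Qed.

Lemma coefficientsP (v : tangent p) :
  v = \sum_m coefficients e v 0 m *: e m.
Proof.
have [a va] := tangent_decomposition v.
exact: (xgetPex 0 (P := [set a : 'rV[R]_n | v = \sum_(m < n) a 0 m *: e m])
  (ex_intro _ a va)).
Qed.

Variable g : riemannian_metric M.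
Local Notation G := (metric_matrix g e).

Lemma metric_at_suml (a : 'I_n -> R) w :
  metric_at g (\sum_m a m *: e m) w = \sum_m a m * metric_at g (e m) w.
Proof.
have Z b u : metric_at g (b *: u) w = b * metric_at g u w.
  have := metric_linearl g b u 0 w; have := metric_linearl g 1 0 0 w.
  by rewrite scaler0 !addr0; lra.
rewrite (big_morph (fun v => metric_at g v w) (id1 := 0) (op1 := +%R)).
- by apply: eq_bigr.
- by move=> u v; exact: metric_atDl.
- by have := Z 0 0; rewrite scale0r mul0r.
Qed.

(** The coordinates of a vector in the kernel of the Gram matrix give a tangent
vector u orthogonal to all e_m, so g(u,u) = 0. *)
Lemma metric_matrix_unit : G \in unitmx.
Proof.
rewrite -row_free_unit -kermx_eq0; apply/eqP/row_matrixP => i.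
set a := row i _; rewrite row0.
have aG : a *m G = 0 by apply: (sub_kermxP _); exact: row_sub.
apply: tangent_free; set u := \sum_m _.
apply/eqP; apply/negP => /negP /(metric_pos g).
suff -> : metric_at g u u = 0 by rewrite ltxx.
rewrite {1}/u metric_at_suml.
transitivity (\sum_m a 0 m * \sum_l (a 0 l * metric_at g (e l) (e m))).
  by apply: eq_bigr => m _; rewrite Defs.metric_sym metric_at_suml.
apply: big1 => m _.
have aGm : \sum_l a 0 l * G l m = 0.
  by have := congr1 (fun A : 'rV[R]_n => A 0 m) aG; rewrite mxE [RHS]mxE.
rewrite -[RHS](mulr0 (a 0 m)); congr (_ * _); rewrite -[RHS]aGm.
by apply: eq_bigr => l _; rewrite [G l m]mxE.
Qed.

Lemma coefficientsE (v : tangent p) m :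
  coefficients e v 0 m = \sum_k metric_at g v (e k) * invmx G k m.
Proof.
pose b := \row_k metric_at g v (e k).
have bE : b = coefficients e v *m G.
  apply/rowP => k; rewrite mxE {1}[v]coefficientsP metric_at_suml mxE.
  by apply: eq_bigr => l _; rewrite mxE.
have -> : coefficients e v = b *m invmx G.
  by rewrite bE mulmxK// metric_matrix_unit.
by rewrite mxE; apply: eq_bigr => k _; rewrite mxE.
Qed.

Lemma inv_metric_matrix_sym i j : invmx G i j = invmx G j i.
Proof.
have Gt : G^T = G by apply/matrixP => k l; rewrite !mxE Defs.metric_sym.
by rewrite -[in LHS]Gt -trmx_inv mxE.
Qed.

End Contraction.

(** * Contraction with the inverse metric *)

Section ScalarCurvature.
Context {R : realType} {n : nat} (M : smooth_manifold R n).
Variables (g : riemannian_metric M) (D D' : affine_connection M).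
Hypotheses (DD' : is_torsion_dual D D') (Dg : is_metric_connection D g)
  (D'g : is_metric_connection D' g).

(** Exchanging m with k, or i with j, does not change the weight H k m * H i j.
So four times the difference of the two sides is the contraction of the
polarised gap, which is zero. *)
Lemma ricci_contraction_eq (c : chart R n M) (F : 'I_n -> vector_field M)
    (p : M) : atlas M c -> chart_dom c p -> coordinate_fields c p F ->
  let H := invmx (metric_matrix g (fun l => vf_at (F l) p)) in
  \sum_i \sum_j \sum_m curvature_coef D F p m i m j * H i j =
  \sum_i \sum_j \sum_m curvature_coef D' F p m i m j * H i j.
Proof.
move=> Mc cp cF H; set e := fun l => vf_at (F l) p.
have e_coord i (f : Cinf M) :
    e i f = 'D_(delta_mx 0 i) (f \o chart_inv c) (c p).
  by have := nbhs_singleton cF; exact.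
pose S m j i k := curvature_gap g D D' (F m) (F j) (F i) (F k) p.
pose Q m j i k := S m j i k * (H k m * H i j).
have Hsym i j : H i j = H j i := inv_metric_matrix_sym e g i j.
have gapE i j m : curvature_coef D F p m i m j - curvature_coef D' F p m i m j =
    \sum_k S m j i k * H k m.
  rewrite /curvature_coef !(coefficientsE Mc cp e_coord g) -sumrB.
  by apply: eq_bigr => k _; rewrite -mulrBl.
apply/eqP; rewrite -subr_eq0 -sumrB.
have -> : \sum_i (\sum_j \sum_m curvature_coef D F p m i m j * H i j -
      \sum_j \sum_m curvature_coef D' F p m i m j * H i j) =
    \sum_i \sum_j \sum_m \sum_k Q m j i k.
  apply: eq_bigr => i _; rewrite -sumrB; apply: eq_bigr => j _.
  rewrite -sumrB; apply: eq_bigr => m _; rewrite -mulrBl gapE mulr_suml.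
  by apply: eq_bigr => k _; rewrite /Q mulrA.
set T := \sum_i _.
have T1 : T = \sum_i \sum_j \sum_m \sum_k Q k j i m.
  by apply: eq_bigr => i _; apply: eq_bigr => j _; exact: exchange_big.
have T2 : T = \sum_i \sum_j \sum_m \sum_k Q m i j k by exact: exchange_big.
have T3 : T = \sum_i \sum_j \sum_m \sum_k Q k i j m.
  by rewrite T1; exact: exchange_big.
have T4 : T + T + (T + T) = 0.
  transitivity (T + (\sum_i \sum_j \sum_m \sum_k Q k j i m) +
      ((\sum_i \sum_j \sum_m \sum_k Q m i j k) +
       (\sum_i \sum_j \sum_m \sum_k Q k i j m))); first by rewrite -T1 -T2 -T3.
  rewrite -!big_split/=; apply: big1 => i _.
  rewrite -!big_split/=; apply: big1 => j _.
  rewrite -!big_split/=; apply: big1 => m _.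
  rewrite -!big_split/=; apply: big1 => k _.
  have := curvature_gap_polarized DD' Dg D'g (F m) (F j) (F i) (F k) p.
  rewrite /Q (Hsym m k) (Hsym j i) -!mulrDl /S => ->.
  by rewrite mul0r.
by apply/eqP; lra.
Qed.

End ScalarCurvature.

Theorem theorem3 (R : realType) (n : nat) (M : smooth_manifold R n)
    (g : riemannian_metric M) (D D' : affine_connection M) :
  is_torsion_dual D D' ->
  is_metric_connection D g -> is_metric_connection D' g ->
  ricci_scalar D g = ricci_scalar D' g /\
  (scalar_flat D g <-> scalar_flat D' g).
Proof.
move=> DD' Dg D'g.
have E : ricci_scalar D g = ricci_scalar D' g.
  apply/funext => p; rewrite /ricci_scalar; congr (xget 0 _).
  apply/seteqP; split=> r [c [F [Mc cp cF ->]]]; exists c, F; split=> //.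
    exact: (ricci_contraction_eq DD' Dg D'g Mc cp cF).
  exact: esym (ricci_contraction_eq DD' Dg D'g Mc cp cF).
by split=> //; rewrite /scalar_flat E.
Qed.
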